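(* Let $X$ be a real Banach space which is an $L$-summand in its bidual, and let $Y$ be a (closed linear) subspace of $X$ which is also an $L$-summand in its bidual. Then $(X,Y,\mathcal{F}(X))$ has weak-$\mathscr{F}_{cwmc}$-SACP, where $\mathcal{F}(X)$ is the family of nonempty finite subsets of $X$ and $\mathscr{F}_{cwmc}$ is the class of all convex, weakly strictly monotone, coercive functions $f:[0,\infty)^N\to[0,\infty)$ (for $F\in\mathcal{F}(X)$ with $card(F)=N$).
   Context: A linear projection $P$ on a Banach space $Z$ is an $L$-projection if $\|z\|=\|Pz\|+\|z-Pz\|$ for all $z$; $Z$ is an $L$-summand in its bidual ($L$-embedded) if its canonical image in $Z^{**}$ is the range of an $L$-projection on $Z^{**}$. On $[0,\infty)^N$ with coordinatewise order, $f$ is monotone if $a\le b$ implies $f(a)\le f(b)$; weakly strictly monotone if monotone and $a_i<b_i$ for all $i$ implies $f(a)<f(b)$; coercive if $f(a)\to\infty$ as $\max_i a_i\to\infty$. For $F=\{x_1,\dots,x_N\}$, $r_f(x,F)=f(\|x-x_1\|,\dots,\|x-x_N\|)$, $\mathrm{rad}_Y^f(F)=\inf_{y\in Y}r_f(y,F)$. Weak-$\mathscr{F}$-SACP: for every $F$, every $f\in\mathscr{F}$ and every sequence $(y_n)\subseteq Y$ with $r_f(y_n,F)\to\mathrm{rad}_Y^f(F)$, $(y_n)$ has a weakly convergent subsequence. *)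

(* Defs.v *)
From HB Require Import structures.
From mathcomp Require Import all_boot all_order all_algebra.
From mathcomp Require Import all_classical all_reals all_analysis.
Set Implicit Arguments. Unset Strict Implicit. Unset Printing Implicit Defensive.
Import Order.TTheory GRing.Theory Num.Theory.
Import numFieldNormedType.Exports.
Local Open Scope classical_set_scope.
Local Open Scope ring_scope.

Section Duals.
Variable R : realType.

Record dual (V : normedModType R) := Dual {
  dfun : V -> R;
  dfun_linear : forall (a : R) (x y : V), dfun (a *: x + y) = a * dfun x + dfun y;
  dfun_cont : continuous dfun }.

Definition dnorm (V : normedModType R) (g : dual V) : R :=
  sup [set `|dfun g x| | x in [set x : V | `|x| <= 1]].

Record bidual (V : normedModType R) := Bidual {
  bfun : dual V -> R;
  bfun_linear : forall (a : R) (g h k : dual V),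
     (forall x, dfun k x = a * dfun g x + dfun h x) ->
     bfun k = a * bfun g + bfun h;
  bfun_bounded : exists C : R, forall g : dual V, `|bfun g| <= C * dnorm g }.

Definition bnorm (V : normedModType R) (z : bidual V) : R :=
  sup [set `|bfun z g| | g in [set g : dual V | dnorm g <= 1]].

Definition is_Lprojection (V : normedModType R) (P : bidual V -> bidual V) : Prop :=
  (forall (a : R) (z1 z2 z3 : bidual V),
      (forall g, bfun z3 g = a * bfun z1 g + bfun z2 g) ->
      forall g, bfun (P z3) g = a * bfun (P z1) g + bfun (P z2) g) /\
  (forall z g, bfun (P (P z)) g = bfun (P z) g) /\
  (forall z w : bidual V, (forall g, bfun w g = bfun z g - bfun (P z) g) ->
      bnorm z = bnorm (P z) + bnorm w).

Definition L_embedded (V : normedModType R) : Prop :=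
  exists P : bidual V -> bidual V, is_Lprojection P /\
    forall z : bidual V,
      (exists w, forall g, bfun (P w) g = bfun z g) <->
      (exists x : V, forall g, bfun z g = dfun g x).

Definition weak_cvg (V : normedModType R) (u : nat -> V) (l : V) : Prop :=
  forall g : dual V, (fun n => dfun g (u n)) @ \oo --> dfun g l.

Definition nonnegv N (a : 'I_N -> R) := forall i, 0 <= a i.

Definition in_Fcwmc N (f : ('I_N -> R) -> R) : Prop :=
  (forall a, nonnegv a -> 0 <= f a) /\
  (forall a b (t : R), nonnegv a -> nonnegv b -> 0 <= t <= 1 ->
     f (fun i => t * a i + (1 - t) * b i) <= t * f a + (1 - t) * f b) /\
  (forall a b, nonnegv a -> nonnegv b -> (forall i, a i <= b i) -> f a <= f b) /\
  (forall a b, nonnegv a -> nonnegv b -> (forall i, a i < b i) -> f a < f b) /\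
  (forall M : R, exists K : R, forall a, nonnegv a ->
     (exists i, K <= a i) -> M <= f a).

(* r_f(x, F) for F = {x_1,...,x_N} enumerated by xs *)
Definition rf (X : normedModType R) N (f : ('I_N -> R) -> R) (xs : 'I_N -> X) (x : X) : R :=
  f (fun i => `|x - xs i|).

(* rad^f_Y(F), Y given via the isometric embedding iY : Y -> X *)
Definition radf (X Y : normedModType R) (iY : Y -> X) N (f : ('I_N -> R) -> R)
  (xs : 'I_N -> X) : R :=
  inf [set rf f xs (iY y) | y in [set: Y]].

End Duals.

(* Main.v *)
Require Import Defs.
From HB Require Import structures.
From mathcomp Require Import all_boot all_order all_algebra.
From mathcomp Require Import all_classical all_reals all_analysis.
From mathcomp Require Import ring lra.
Set Implicit Arguments. Unset Strict Implicit. Unset Printing Implicit Defensive.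
Import Order.TTheory GRing.Theory Num.Theory.
Import numFieldNormedType.Exports.
Local Open Scope classical_set_scope.
Local Open Scope ring_scope.

(* A minimizing sequence in Y is bounded by coercivity.  Let z in Y** be its limit
   along a free ultrafilter and write z = y + z_s with y in Y and z_s in the
   L-complement of Y.  The decomposition of X** extends that of Y** (if x is the
   X-part of z_s, then |x + y'| = |x| + |y'| for all y' in Y, hence by Hahn-Banach
   also |z_s - x| = |z_s| + |x|, while |z_s| = |x| + |z_s - x|; so x = 0).  Therefore
   |y - x_i| + |z_s| = |z - x_i| <= lim |y_n - x_i| for every i, and z_s <> 0 would
   make r_f(y, F) smaller than the radius by weak strict monotonicity.  So every
   ultrafilter limit of the sequence lies in Y, and the argument of Eberlein and
   Smulian provides a weakly convergent subsequence. *)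

(** * Hahn-Banach theorem through minimal sublinear functionals *)

(** The reverse homogeneity inequality follows from the stated one with [t^-1] in place of [t]. *)
Definition sublinear {R : realType} {V : lmodType R} (p : V -> R) : Prop :=
  (forall x y, p (x + y) <= p x + p y) /\
  (forall t x, 0 < t -> p (t *: x) <= t * p x).

Lemma sublinear0 (R : realType) (V : lmodType R) (p : V -> R) :
  sublinear p -> p 0 = 0.
Proof.
move=> [_ pZ]; have := pZ 2 0; have := pZ 2^-1 0.
rewrite !scaler0 invr_gt0 ltr0n => /(_ isT) h1 /(_ isT) h2.
by apply/eqP; rewrite eq_le; apply/andP; split; lra.
Qed.

Lemma sublinear_ge (R : realType) (V : lmodType R) (p : V -> R) x y :
  sublinear p -> p y - p (- x) <= p (x + y).
Proof.
by move=> [pD _]; have := pD (- x) (x + y); rewrite addKr; lra.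
Qed.

(** [q] is the infimal convolution [inf (p (x + v) - r)] over the cone [S]; the bound [r <= p v]
    keeps it at least [- p (- x)]. A linear functional below [q] is at least [r] at [v], since
    [q (- v) <= p 0 - r]. *)
Lemma sublinear_infconv (R : realType) (V : lmodType R) (p : V -> R)
    (S : V -> R -> Prop) :
  sublinear p ->
  S 0 0 ->
  (forall v r w s, S v r -> S w s -> S (v + w) (r + s)) ->
  (forall t v r, 0 < t -> S v r -> S (t *: v) (t * r)) ->
  (forall v r, S v r -> r <= p v) ->
  exists q, [/\ sublinear q, forall x, q x <= p x &
    forall x v r, S v r -> q x <= p (x + v) - r].
Proof.
move=> psub S0 SD SZ Sp.
pose A x := [set a | exists v r, S v r /\ a = p (x + v) - r].
have A0 x : A x !=set0.
  by exists (p (x + 0) - 0), 0, 0.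
have Alb x : has_lbound (A x).
  exists (- p (- x)) => _ [v [r [/Sp rv ->]]].
  by have := sublinear_ge x v psub; lra.
have q_le x v r : S v r -> inf (A x) <= p (x + v) - r.
  by move=> Svr; apply: ge_inf => //; exists v, r.
exists (fun x => inf (A x)); split => //; last first.
  by move=> x; have := q_le x 0 0 S0; rewrite addr0 subr0.
have [pD pZ] := psub.
split=> [x y|t x t0].
  rewrite -lerBlDr; apply: lb_le_inf => // _ [v [r [Svr ->]]].
  rewrite lerBlDr -lerBlDl; apply: lb_le_inf => // _ [w [s [Sws ->]]].
  have := q_le (x + y) _ _ (SD _ _ _ _ Svr Sws).
  by rewrite addrACA; have := pD (x + v) (y + w); lra.
rewrite mulrC -ler_pdivrMr//; apply: lb_le_inf => // _ [v [r [Svr ->]]].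
rewrite ler_pdivrMr//; apply: (le_trans (q_le _ _ _ (SZ _ _ _ t0 Svr))).
by rewrite -scalerDr; have := pZ t (x + v) t0; lra.
Qed.

(** Zorn's lemma on the sublinear functionals below [p], ordered downwards; a chain is bounded by
    its pointwise infimum, which stays above [- p (- x)]. *)
Lemma minimal_sublinear (R : realType) (V : lmodType R) (p : V -> R) :
  sublinear p ->
  exists q, [/\ sublinear q, forall x, q x <= p x &
    forall q', sublinear q' -> (forall x, q' x <= q x) -> q' = q].
Proof.
move=> psub.
pose P (q : V -> R) := sublinear q /\ forall x, q x <= p x.
pose T := {q | P q}.
pose le (q1 q2 : T) := `[< forall x, sval q2 x <= sval q1 x >].
have [|||A Atot|[q [qsub qp]] qmax] := @Zorn T le.
- by move=> q; apply/asboolP.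
- move=> q1 q2 q3 /asboolP h12 /asboolP h23; apply/asboolP => x.
  exact: le_trans (h12 x).
- move=> [q1 h1] [q2 h2] /asboolP/= h12 /asboolP/= h21.
  apply: eq_exist => /=; apply/funext => x; apply/eqP.
  by rewrite eq_le h12 h21.
- have [[q0 Aq0]|A0] := pselect (A !=set0); last first.
    exists (exist P p (conj psub (fun x => lexx (p x)))) => q Aq.
    by exfalso; apply: A0; exists q.
  pose E x := [set sval q x | q in A].
  have E0 x : E x !=set0 by exists (sval q0 x), q0.
  have Elb x : has_lbound (E x).
    exists (- p (- x)) => _ [[q [qsub qp]] _ /= <-].
    have := sublinear_ge x 0 qsub; rewrite addr0 (sublinear0 qsub).
    by have := qp (- x); lra.
  have Einf x q : A q -> inf (E x) <= sval q x.
    by move=> Aq; apply: ge_inf => //; exists q.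
  have isub : sublinear (fun x => inf (E x)).
    split=> [x y|t x t0].
      rewrite -lerBlDr; apply: lb_le_inf => // _ [q1 Aq1 <-].
      rewrite lerBlDr -lerBlDl; apply: lb_le_inf => // _ [q2 Aq2 <-].
      (* The smaller of the two members of the chain serves for both [x] and [y]. *)
      rewrite lerBlDr; have [/asboolP h|/asboolP h] := Atot _ _ Aq1 Aq2.
        have := Einf (x + y) _ Aq2; have := (svalP q2).1.1 x y.
        by have := h x; lra.
      have := Einf (x + y) _ Aq1; have := (svalP q1).1.1 x y.
      by have := h y; lra.
    rewrite mulrC -ler_pdivrMr//; apply: lb_le_inf => // _ [q Aq <-].
    rewrite ler_pdivrMr// mulrC; apply: (le_trans (Einf _ _ Aq)).
    exact: (svalP q).1.2.
  have ip x : inf (E x) <= p x.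
    by apply: (le_trans (Einf x _ Aq0)); exact: (svalP q0).2.
  exists (exist P _ (conj isub ip)) => q Aq.
  by apply/asboolP => x /=; exact: Einf.
exists q; split => // q' q'sub q'q.
have q'p x : q' x <= p x by exact: le_trans (qp x).
have h : le (exist P q (conj qsub qp)) (exist P q' (conj q'sub q'p)).
  exact/asboolP.
exact: (congr1 sval (qmax _ h)).
Qed.

(** The infimal convolution of [q] with the ray through [y], carrying the values [t * q y], is a
    sublinear minorant, hence [q] itself; this yields [q x <= q (x + y) - q y], the missing
    superadditivity. *)
Lemma minimal_sublinear_linear (R : realType) (V : lmodType R) (q : V -> R) :
  sublinear q ->
  (forall q', sublinear q' -> (forall x, q' x <= q x) -> q' = q) ->
  forall a x y, q (a *: x + y) = a * q x + q y.
Proof.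
move=> qsub qmin; have [qD qZ] := qsub; have q0 := sublinear0 qsub.
have qDE x y : q (x + y) = q x + q y.
  apply/eqP; rewrite eq_le qD /=.
  pose S v r := exists2 t : R, 0 <= t & v = t *: y /\ r = t * q y.
  have [||||q' [q'sub q'q q'S]] := @sublinear_infconv _ _ q S qsub.
  - by exists 0; rewrite ?scale0r ?mul0r.
  - move=> _ _ _ _ [t t0 [-> ->]] [s s0 [-> ->]]; exists (t + s).
      exact: addr_ge0.
    by rewrite scalerDl mulrDl.
  - move=> t _ _ t0 [s s0 [-> ->]]; exists (t * s).
      by rewrite mulr_ge0// ltW.
    by rewrite scalerA mulrA.
  - move=> _ _ [t t0 [-> ->]].
    move: t0; rewrite le_eqVlt => /predU1P[<-|t0].
      by rewrite mul0r scale0r q0.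
    have ti : 0 < t^-1 by rewrite invr_gt0.
    have := qZ t^-1 (t *: y) ti; rewrite scalerA mulVf ?gt_eqF// scale1r.
    by rewrite -ler_pdivrMl// invrK.
  - have := q'S x y (q y); rewrite (qmin _ q'sub q'q).
    have : S y (q y) by exists 1; rewrite ?scale1r ?mul1r.
    by move=> Sy /(_ Sy); lra.
have qN x : q (- x) = - q x.
  by apply/eqP; rewrite -addr_eq0 -qDE addNr q0.
have qZE t x : 0 < t -> q (t *: x) = t * q x.
  move=> t0; apply/eqP; rewrite eq_le qZ//=.
  by have := qZ t (- x) t0; rewrite scalerN !qN mulrN lerN2.
move=> a x y; rewrite qDE; congr (_ + _).
have [a0|a0|->] := ltgtP a 0; last by rewrite scale0r mul0r q0.
  rewrite -[a]opprK scaleNr qN qZE ?oppr_gt0//.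
  by rewrite !mulNr.
exact: qZE.
Qed.

(** [S] is the graph of a linear functional on a subspace. A minimal sublinear functional below the
    infimal convolution of [p] with [S] is linear; since [S] also contains [(-v, -r)], its value at
    [v] is exactly [r]. *)
Lemma hahn_banach (R : realType) (V : lmodType R) (p : V -> R)
    (S : V -> R -> Prop) :
  sublinear p ->
  S 0 0 ->
  (forall a v r w s, S v r -> S w s -> S (a *: v + w) (a * r + s)) ->
  (forall v r, S v r -> r <= p v) ->
  exists l : V -> R, [/\ forall a x y, l (a *: x + y) = a * l x + l y,
    forall x, l x <= p x & forall v r, S v r -> l v = r].
Proof.
move=> psub S0 Slin Sp.
have [||q [qsub qp qS]] := sublinear_infconv psub S0 _ _ Sp.
- by move=> v r w s Sv /(Slin 1 _ _ _ _ Sv); rewrite scale1r mul1r.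
- by move=> t v r _ Sv; have := Slin t _ _ _ _ Sv S0; rewrite !addr0.
have [l [lsub lq lmin]] := minimal_sublinear qsub.
have llin := minimal_sublinear_linear lsub lmin.
have l_le v r : S v r -> l v <= r.
  move=> Sv; have := Slin (-1) _ _ _ _ Sv S0.
  rewrite scaleN1r mulN1r !addr0 => /(qS v).
  by rewrite subrr (sublinear0 psub) sub0r opprK; apply: le_trans.
exists l; split=> [//|x|v r Sv]; first exact: le_trans (qp x).
apply/eqP; rewrite eq_le l_le//=.
have := Slin (-1) _ _ _ _ Sv S0; rewrite scaleN1r mulN1r !addr0 => /l_le.
by have := llin (-1) v 0; rewrite (sublinear0 lsub) scaleN1r !addr0 mulN1r; lra.
Qed.

(** * Dual norm and norming functionals *)

Section Dual.
Variables (R : realType) (V : normedModType R).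
Implicit Types (g : dual V) (x y : V).

Lemma dfun0 g : dfun g 0 = 0.
Proof. by have := dfun_linear g (-1) 0 0; rewrite scaleN1r addNr mulN1r addNr. Qed.

Lemma dfunD g x y : dfun g (x + y) = dfun g x + dfun g y.
Proof. by have := dfun_linear g 1 x y; rewrite scale1r mul1r. Qed.

Lemma dfunZ g a x : dfun g (a *: x) = a * dfun g x.
Proof. by have := dfun_linear g a x 0; rewrite dfun0 !addr0. Qed.

Lemma dfunN g x : dfun g (- x) = - dfun g x.
Proof. by rewrite -scaleN1r dfunZ mulN1r. Qed.

Lemma dfunB g x y : dfun g (x - y) = dfun g x - dfun g y.
Proof. by rewrite dfunD dfunN. Qed.

Lemma linear_bounded_continuous (l : V -> R) (C : R) :
  (forall a x y, l (a *: x + y) = a * l x + l y) ->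
  (forall x, `|l x| <= C * `|x|) -> continuous l.
Proof.
move=> llin lC x; apply/cvgrPdist_lt => e e0.
have C0 : 0 < `|C| + 1 by rewrite ltr_wpDl.
near=> z.
have -> : l x - l z = l (x - z).
  by have := llin (-1) z x; rewrite scaleN1r addrC mulN1r => ->; rewrite addrC.
apply: (le_lt_trans (lC _)); apply: (@le_lt_trans _ _ ((`|C| + 1) * `|x - z|)).
  by rewrite ler_wpM2r// (le_trans (ler_norm C))// lerDl.
rewrite -ltr_pdivlMl//.
by near: z; apply: cvgr_dist_lt => //; rewrite mulr_gt0// invr_gt0.
Unshelve. all: by end_near. Qed.

Lemma dfun_bounded g : exists2 C, 0 <= C & forall x, `|dfun g x| <= C * `|x|.
Proof.
have /cvgrPdist_lt/(_ 1 ltr01) := @dfun_cont _ _ g 0.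
move/nbhs_norm0P => [d /= d0 dg].
exists (2 / d); first by rewrite divr_ge0// ltW.
move=> x; have [->|x0] := eqVneq x 0; first by rewrite dfun0 !normr0 mulr0.
have nx : 0 < `|x| by rewrite normr_gt0.
(* [t *: x] has norm [d / 2], strictly inside the ball of radius [d] where [dfun g] is below 1 in
   absolute value. *)
pose t := d / 2 / `|x|.
have t0 : 0 < t by rewrite !divr_gt0.
have : `|dfun g 0 - dfun g (t *: x)| < 1.
  apply: dg => /=; rewrite normrZ gtr0_norm// /t divfK ?gt_eqF//.
  by rewrite ltr_pdivrMr// ltr_pMr// ltr1n.
rewrite dfun0 sub0r normrN dfunZ normrM (gtr0_norm t0) => /ltW.
rewrite -ler_pdivlMl// mulr1 => /le_trans; apply.
suff -> : t^-1 = 2 / d * `|x| by [].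
by rewrite /t; field; rewrite !gt_eqF.
Qed.

Lemma dnormP g C : 0 <= C ->
  dnorm g <= C <-> forall x, `|dfun g x| <= C * `|x|.
Proof.
move=> C0.
have ub : has_ubound [set `|dfun g x| | x in [set x : V | `|x| <= 1]].
  have [D D0 gD] := dfun_bounded g; exists D => _ [x /= x1 <-].
  by rewrite (le_trans (gD x))// ler_piMr.
split=> [gC x|gC].
  have [->|x0] := eqVneq x 0; first by rewrite dfun0 !normr0 mulr0.
  have nx : 0 < `|x| by rewrite normr_gt0.
  rewrite -ler_pdivrMr//; apply: le_trans gC.
  apply: (ub_le_sup ub); exists (`|x|^-1 *: x) => /=.
    by rewrite normrZ normfV normr_id mulVf ?gt_eqF.
  by rewrite dfunZ normrM normfV normr_id mulrC.
apply: ge_sup => [|_ [x /= x1 <-]].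
  by exists `|dfun g 0|; exists 0; rewrite //= normr0 ler01.
by rewrite (le_trans (gC x))// ler_piMr.
Qed.

Lemma dnorm_ge0 g : 0 <= dnorm g.
Proof.
have [C C0 gC] := dfun_bounded g.
apply: (@le_trans _ _ `|dfun g 0|); first by rewrite dfun0 normr0.
apply: ub_le_sup; last by exists 0; rewrite //= normr0 ler01.
exists C => _ [x /= x1 <-].
by rewrite (le_trans (gC x))// ler_piMr.
Qed.

Lemma dfun_le g x : `|dfun g x| <= dnorm g * `|x|.
Proof. exact: (dnormP g (dnorm_ge0 g)).1. Qed.

Lemma dnorm_le1P g : dnorm g <= 1 <-> forall x, `|dfun g x| <= `|x|.
Proof.
rewrite (dnormP g ler01).
by split=> h x; have := h x; rewrite mul1r.
Qed.

Lemma dual_extension (S : V -> R -> Prop) :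
  S 0 0 ->
  (forall a v r w s, S v r -> S w s -> S (a *: v + w) (a * r + s)) ->
  (forall v r, S v r -> r <= `|v|) ->
  exists2 g : dual V, dnorm g <= 1 & forall v r, S v r -> dfun g v = r.
Proof.
move=> S0 Slin Sn.
have nsub : sublinear (fun x : V => `|x|).
  by split=> [x y|t x t0]; rewrite ?ler_normD// normrZ gtr0_norm.
have [l [llin ln lS]] := hahn_banach nsub S0 Slin Sn.
have ln' x : `|l x| <= 1 * `|x|.
  rewrite mul1r ler_norml ln andbT lerNl.
  have := llin (-1) x 0; have := llin 1 0 0.
  rewrite scaler0 scaleN1r mul1r mulN1r !addr0.
  by have := ln (- x); rewrite normrN; lra.
exists (Dual llin (linear_bounded_continuous llin ln')); last exact: lS.
exact/(dnormP _ ler01).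
Qed.

Lemma norming_functional x : exists2 g, dnorm g <= 1 & dfun g x = `|x|.
Proof.
pose S v r := exists t : R, v = t *: x /\ r = t * `|x|.
have [||_ _ [t [-> ->]]|g g1 gS] := @dual_extension S.
- by exists 0; rewrite scale0r mul0r.
- move=> a _ _ _ _ [t [-> ->]] [s [-> ->]]; exists (a * t + s).
  by rewrite scalerDl mulrDl scalerA mulrA.
- by rewrite normrZ ler_wpM2r// ler_norm.
- by exists g => //; apply: gS; exists 1; rewrite scale1r mul1r.
Qed.

Lemma dual_separates x y : (forall g, dfun g x = dfun g y) -> x = y.
Proof.
move=> xy; apply/eqP; rewrite -subr_eq0 -normr_eq0.
by have [g _ <-] := norming_functional (x - y); rewrite dfunB xy subrr.
Qed.

End Dual.

(** * Bidual norm, canonical embedding and L-decompositions *)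

Section Bidual.
Variables (R : realType) (V : normedModType R).
Implicit Types (g h k : dual V) (z w : bidual V).

(** Functionals with the same values may differ as records; linearity, being stated through values,
    gives extensionality with the scalar 0. *)
Lemma bfun_ext z g h : (forall x, dfun g x = dfun h x) -> bfun z g = bfun z h.
Proof.
move=> gh; have h0 : bfun z h = 0 * bfun z g + bfun z h by rewrite mul0r add0r.
by rewrite h0; apply: bfun_linear => x; rewrite gh mul0r add0r.
Qed.

Lemma bnorm_ge z g : dnorm g <= 1 -> `|bfun z g| <= bnorm z.
Proof.
move=> g1; apply: ub_le_sup; last by exists g.
have [C zC] := bfun_bounded z; exists `|C| => _ [h /= h1 <-].
rewrite (le_trans (zC h))// (le_trans (ler_norm _))// normrM ler_piMr//.
by rewrite ger0_norm ?dnorm_ge0.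
Qed.


Lemma bnorm_le z C : (forall g, dnorm g <= 1 -> bfun z g <= C) -> bnorm z <= C.
Proof.
move=> zC; have [g0 g01 _] := norming_functional (0 : V).
apply: ge_sup; first by exists `|bfun z g0|, g0.
move=> _ [g /= g1 <-]; rewrite ler_norml zC// andbT lerNl.
have llin (a : R) (x y : V) :
  - dfun g (a *: x + y) = a * - dfun g x + - dfun g y.
  by rewrite dfun_linear mulrN opprD.
have lb x : `|- dfun g x| <= 1 * `|x|.
  by rewrite normrN mul1r; move/dnorm_le1P : g1.
pose h := Dual llin (linear_bounded_continuous llin lb).
have -> : - bfun z g = bfun z h.
  (* Linearity speaks of combinations [a g + h] only, so [- g] is presented as [(-2) g + g]. *)
  rewrite (@bfun_linear _ _ z (-2) g g h) => [|x]; first by lra.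
  by rewrite /=; lra.
by apply: zC; exact/(dnormP _ ler01).
Qed.

Lemma bnorm_ge0 z : 0 <= bnorm z.
Proof.
have [g g1 _] := norming_functional (0 : V).
exact: le_trans (bnorm_ge z g1).
Qed.

Lemma bnorm_eq0 z g : bnorm z = 0 -> bfun z g = 0.
Proof.
(* The factor [c] brings [g] into the unit ball; the added 1 covers a [g] of norm 0. *)
move=> z0; pose c := (dnorm g + 1)^-1.
have c0 : 0 < c by rewrite invr_gt0 ltr_wpDl ?dnorm_ge0.
have llin (a : R) (x y : V) :
    c * dfun g (a *: x + y) = a * (c * dfun g x) + c * dfun g y.
  by rewrite dfun_linear mulrDr mulrCA.
have lb x : `|c * dfun g x| <= 1 * `|x|.
  rewrite mul1r normrM (gtr0_norm c0) ler_pdivrMl ?ltr_wpDl ?dnorm_ge0//.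
  by apply: (le_trans (dfun_le g x)); rewrite ler_wpM2r// lerDl.
pose h := Dual llin (linear_bounded_continuous llin lb).
have h1 : dnorm h <= 1 by exact/(dnormP _ ler01).
have zh : bfun z h = c * bfun z g.
  rewrite (@bfun_linear _ _ z (c - 1) g g h) => [|x /=]; by ring.
have := bnorm_ge z h1.
by rewrite z0 normr_le0 zh mulf_eq0 gt_eqF//= => /eqP.
Qed.

Lemma eval_at_linear x (a : R) g h k :
  (forall x, dfun k x = a * dfun g x + dfun h x) ->
  dfun k x = a * dfun g x + dfun h x.
Proof. exact. Qed.

Lemma eval_at_bounded x : exists C : R, forall g, `|dfun g x| <= C * dnorm g.
Proof. by exists `|x| => g; rewrite mulrC dfun_le. Qed.

Definition eval_at x : bidual V :=
  @Bidual R V (fun g => dfun g x) (eval_at_linear x) (eval_at_bounded x).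

Lemma bnorm_eval_at x : bnorm (eval_at x) = `|x|.
Proof.
apply/eqP; rewrite eq_le; apply/andP; split.
  apply: bnorm_le => g /dnorm_le1P h /=.
  exact: le_trans (ler_norm _) (h x).
have [g g1 <-] := norming_functional x.
exact: le_trans (ler_norm _) (bnorm_ge (eval_at x) g1).
Qed.

Lemma bcomb_linear (b : R) z w (a : R) g h k :
  (forall x, dfun k x = a * dfun g x + dfun h x) ->
  b * bfun z k + bfun w k =
  a * (b * bfun z g + bfun w g) + (b * bfun z h + bfun w h).
Proof. by move=> kE; rewrite !(bfun_linear _ kE); ring. Qed.

Lemma bcomb_bounded (b : R) z w :
  exists C : R, forall g, `|b * bfun z g + bfun w g| <= C * dnorm g.
Proof.
have [C zC] := bfun_bounded z; have [D wD] := bfun_bounded w.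
exists (`|b| * C + D) => g; rewrite (le_trans (ler_normD _ _))// mulrDl lerD//.
by rewrite normrM -mulrA ler_wpM2l.
Qed.

Definition bcomb (b : R) z w : bidual V :=
  Bidual (@bcomb_linear b z w) (bcomb_bounded b z w).

Lemma eq_bnorm z w : (forall g, bfun z g = bfun w g) -> bnorm z = bnorm w.
Proof.
by move=> zw; rewrite /bnorm; congr (sup (image _ _)); apply/funext => g; rewrite zw.
Qed.

(** [p] is the L-projection of the bidual onto [V], read as a map into [V] itself;
    [bcomb (-1) (eval_at (p z)) z] is the singular part [z - p z]. *)
Definition L_decomposition (p : bidual V -> V) : Prop :=
  [/\ forall a z1 z2 z3,
        (forall g, bfun z3 g = a * bfun z1 g + bfun z2 g) ->
        p z3 = a *: p z1 + p z2,
      forall x, p (eval_at x) = x &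
      forall z, bnorm z = `|p z| + bnorm (bcomb (-1) (eval_at (p z)) z)].

Lemma L_embedded_decomposition :
  L_embedded V -> exists p, L_decomposition p.
Proof.
move=> [P [[Plin [PP Pnorm]] Prange]].
have Peval z : exists x, forall g, bfun (P z) g = dfun g x.
  by apply/Prange; exists z.
have [p pP] := choice Peval.
exists p; split.
- move=> a z1 z2 z3 z3E; apply: dual_separates => g.
  by rewrite dfun_linear -!pP; exact: Plin.
- move=> x; apply: dual_separates => g; rewrite -pP.
  have [w Pw] : exists w, forall g, bfun (P w) g = bfun (eval_at x) g.
    by apply/Prange; exists x.
  rewrite -[RHS]/(bfun (eval_at x) g) -Pw -(PP w).
  (* With scalar 0, linearity of [P] says that [P] respects pointwise equality, here of [eval_at x]
     and [P w]. *)
  have := @Plin 0 (eval_at x) (P w) (eval_at x).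
  by move=> ->; [rewrite mul0r add0r|move=> h; rewrite mul0r add0r Pw].
- move=> z; rewrite -(bnorm_eval_at (p z)).
  have -> : bnorm (eval_at (p z)) = bnorm (P z).
    by apply: eq_bnorm => g; rewrite pP.
  by apply: Pnorm => g /=; rewrite mulN1r pP addrC.
Qed.

End Bidual.

(** * Second adjoint of an isometric embedding *)

Section Transpose.
Variables (R : realType) (X Y : normedModType R) (i : Y -> X).
Hypothesis i_linear :
  forall (a : R) (y1 y2 : Y), i (a *: y1 + y2) = a *: i y1 + i y2.
Hypothesis i_isometry : forall y, `|i y| = `|y|.

Lemma restrict_linear (g : dual X) a y1 y2 :
  dfun g (i (a *: y1 + y2)) = a * dfun g (i y1) + dfun g (i y2).
Proof. by rewrite i_linear dfun_linear. Qed.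

Lemma restrict_le (g : dual X) y : `|dfun g (i y)| <= dnorm g * `|y|.
Proof. by rewrite -i_isometry dfun_le. Qed.

Definition restrict (g : dual X) : dual Y :=
  Dual (restrict_linear g)
    (linear_bounded_continuous (restrict_linear g) (restrict_le g)).

Lemma dnorm_restrict g : dnorm (restrict g) <= dnorm g.
Proof.
by apply/(dnormP _ (dnorm_ge0 g)) => y; exact: restrict_le.
Qed.

Lemma bitranspose_linear (z : bidual Y) (a : R) (g h k : dual X) :
  (forall x, dfun k x = a * dfun g x + dfun h x) ->
  bfun z (restrict k) = a * bfun z (restrict g) + bfun z (restrict h).
Proof. by move=> kE; apply: bfun_linear => y /=. Qed.

Lemma bitranspose_bounded (z : bidual Y) :
  exists C : R, forall g, `|bfun z (restrict g)| <= C * dnorm g.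
Proof.
have [C zC] := bfun_bounded z; exists `|C| => g; rewrite (le_trans (zC _))//.
apply: (@le_trans _ _ (`|C| * dnorm (restrict g))).
  by rewrite ler_wpM2r ?dnorm_ge0// ler_norm.
by rewrite ler_wpM2l// dnorm_restrict.
Qed.

Definition bitranspose (z : bidual Y) : bidual X :=
  Bidual (bitranspose_linear z) (bitranspose_bounded z).

(* The functional [(t, y) |-> g y - t * `|x|] on [R x + i(Y)] has norm at most one
   because the sum is an l^1-sum. *)
Lemma L1_extension (x : X) (g : dual Y) :
  (forall y, `|x + i y| = `|x| + `|y|) -> dnorm g <= 1 ->
  exists h : dual X, [/\ dnorm h <= 1, dfun h x = - `|x| &
    forall y, dfun h (i y) = dfun g y].
Proof.
move=> xY /dnorm_le1P g1.
have i0 : i 0 = 0.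
  by have := i_linear (-1) 0 0; rewrite scaleN1r addNr scaleN1r addNr.
have iZ a y : i (a *: y) = a *: i y.
  by have := i_linear a y 0; rewrite i0 !addr0.
pose S v r := exists (t : R) y, v = t *: x + i y /\ r = - (t * `|x|) + dfun g y.
have nS t y : `|t *: x + i y| = `|t| * `|x| + `|y|.
  have [->|t0] := eqVneq t 0.
    by rewrite scale0r normr0 mul0r !add0r i_isometry.
  have -> : t *: x + i y = t *: (x + i (t^-1 *: y)).
    by rewrite scalerDr iZ scalerA divff// scale1r.
  by rewrite normrZ xY mulrDr normrZ normfV mulrA divff ?normr_eq0// mul1r.
have [||_ _ [t [y [-> ->]]]|h h1 hS] := @dual_extension _ _ S.
- by exists 0, 0; rewrite scale0r mul0r i0 dfun0 oppr0 !addr0.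
- move=> a _ _ _ _ [t [y [-> ->]]] [s [y' [-> ->]]].
  exists (a * t + s), (a *: y + y'); rewrite i_linear dfun_linear; split.
    by rewrite scalerDr scalerDl scalerA addrACA.
  by ring.
- rewrite nS lerD//; last exact: le_trans (ler_norm _) (g1 y).
  by rewrite -mulNr ler_wpM2r// -normrN ler_norm.
exists h; split => // [|y]; apply: hS.
  by exists 1, 0; rewrite scale1r mul1r i0 dfun0 !addr0.
by exists 0, y; rewrite scale0r mul0r oppr0 !add0r.
Qed.

Lemma restrict_surj (g : dual Y) : dnorm g <= 1 ->
  exists2 h : dual X, dnorm h <= 1 & forall y, dfun h (i y) = dfun g y.
Proof.
move=> g1; have [y|h [h1 _ hg]] := @L1_extension 0 g _ g1; last by exists h.
by rewrite normr0 !add0r i_isometry.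
Qed.

(** Restriction maps the dual unit ball of [X] onto that of [Y], so both suprema run over the same
    values. *)
Lemma bnorm_bitranspose z : bnorm (bitranspose z) = bnorm z.
Proof.
apply/eqP; rewrite eq_le; apply/andP; split; apply: bnorm_le => g g1.
  apply: le_trans (ler_norm _) (bnorm_ge z _).
  exact: le_trans (dnorm_restrict g) g1.
have [h h1 hg] := restrict_surj g1.
have -> : bfun z g = bfun z (restrict h) by apply: bfun_ext => y; rewrite /= hg.
exact: le_trans (ler_norm _) (bnorm_ge (bitranspose z) h1).
Qed.

End Transpose.

(** * Compatibility of the L-decompositions of [X] and [Y] *)

(** Adding a point of [V] shifts [p z] and leaves the singular part [z - p z] unchanged. *)
Lemma L_decomposition_translate (R : realType) (V : normedModType R)
    (p : bidual V -> V) (z : bidual V) (x : V) :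
  L_decomposition p ->
  bnorm (bcomb 1 (eval_at x) z) =
    `|x + p z| + bnorm (bcomb (-1) (eval_at (p z)) z).
Proof.
move=> [plin pc pn]; rewrite pn.
rewrite (plin 1 (eval_at x) z) // pc scale1r; congr (_ + _).
by apply: eq_bnorm => g /=; rewrite dfunD; ring.
Qed.

Section Subspace.
Variables (R : realType) (X Y : normedModType R) (i : Y -> X).
Hypothesis i_linear :
  forall (a : R) (y1 y2 : Y), i (a *: y1 + y2) = a *: i y1 + i y2.
Hypothesis i_isometry : forall y, `|i y| = `|y|.
Let J := bitranspose i_linear i_isometry.

Lemma L_decomposition_singular (p : bidual X -> X) (q : bidual Y -> Y) z :
  L_decomposition p -> L_decomposition q -> q z = 0 -> p (J z) = 0.
Proof.
move=> pL qL qz0; set x := p (J z).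
have Jn w : bnorm (J w) = bnorm w by exact: bnorm_bitranspose.
pose s := bnorm (bcomb (-1) (eval_at x) (J z)).
have Jz : bnorm z = `|x| + s by rewrite -Jn; have [_ _ ->] := pL.
(* The norm of [z + y] is [|y| + |z|] by the decomposition for [Y] and [|x + i y| + s] by the one
   for [X]; moreover [|z| = |x| + s]. *)
have xY y : `|x + i y| = `|x| + `|y|.
  have := L_decomposition_translate z y qL.
  have := L_decomposition_translate (J z) (i y) pL.
  rewrite qz0 addr0 -/x -/s.
  have -> : bnorm (bcomb 1 (eval_at (i y)) (J z)) = bnorm (bcomb 1 (eval_at y) z).
    rewrite -Jn; apply: eq_bnorm => g /=; ring.
  have -> : bnorm (bcomb (-1) (eval_at 0) z) = bnorm z.
    by apply: eq_bnorm => g /=; rewrite dfun0; ring.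
  rewrite [i y + x]addrC => -> ; rewrite Jz; move=> h; lra.
(* Together with [|z| = |x| + s] this bound gives [2 |x| <= 0]. It is obtained by testing [J z - x]
   on functionals that extend [g] and take the value [- |x|] at [x]. *)
suff : bnorm z + `|x| <= s.
  by move=> h; apply/eqP; rewrite -normr_eq0 eq_le normr_ge0 andbT; lra.
rewrite -lerBrDr; apply: bnorm_le => g g1.
have [h [h1 hx hg]] := L1_extension i_linear i_isometry xY g1.
have := le_trans (ler_norm _) (bnorm_ge (bcomb (-1) (eval_at x) (J z)) h1).
rewrite /= hx (@bfun_ext _ _ z _ g)// -/s.
lra.
Qed.

(** Split [z = q z + zs]. As [q zs = 0], the image [J zs] has no part in [X], and [J z - x] is its
    translate by [i (q z) - x]. *)
Lemma L_decomposition_dist (p : bidual X -> X) (q : bidual Y -> Y) z x :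
  L_decomposition p -> L_decomposition q ->
  bnorm (bcomb (-1) (eval_at x) (J z)) =
    `|i (q z) - x| + bnorm (bcomb (-1) (eval_at (q z)) z).
Proof.
move=> pL qL; set zs := bcomb (-1) (eval_at (q z)) z.
have qzs : q zs = 0.
  have [qlin qc _] := qL.
  by rewrite (qlin (-1) (eval_at (q z)) z)// qc scaleN1r addNr.
have pJ := L_decomposition_singular pL qL qzs.
have := L_decomposition_translate (J zs) (i (q z) - x) pL.
rewrite pJ addr0.
have -> : bnorm (bcomb (-1) (eval_at 0) (J zs)) = bnorm zs.
  rewrite -[RHS](bnorm_bitranspose i_linear i_isometry).
  by apply: eq_bnorm => g /=; rewrite dfun0; ring.
by move=> <-; apply: eq_bnorm => g /=; rewrite dfunB; ring.
Qed.

End Subspace.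

(** * Limits along ultrafilters *)

Lemma ultra_fmap (T T' : Type) (f : T -> T') (U : set_system T) :
  UltraFilter U -> UltraFilter (f @ U).
Proof.
move=> UU; split=> [|G GP UG]; first exact: fmap_proper_filter.
apply/seteqP; split=> // A GA.
have [//|UA] := in_ultra_setVsetC (f @^-1` A) UU.
have GA' : G (~` A) by exact: UG.
have : G set0 by rewrite -(setICr A); exact: filterI.
by move=> /filter_ex[].
Qed.

Lemma ultra_bounded_cvg (R : realType) (T : Type) (U : set_system T)
    (h : T -> R) (B : R) :
  UltraFilter U -> (\forall n \near U, `|h n| <= B) ->
  exists l : R, h @ U --> l.
Proof.
move=> UU hB; have FU := ultra_fmap h UU.
have := @segment_compact R (- B) B; rewrite compact_ultra => /(_ (h @ U) FU).
case=> [|l [_ hl]]; last by exists l.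
by apply: filterS hB => n; rewrite ler_norml /= in_itv.
Qed.

(** Weak-star compactness of balls in the bidual: each [dfun g (u n)] stays in a compact interval,
    and linearity and the bound [B] pass to the limits. *)
Lemma ultralimit_bidual (R : realType) (V : normedModType R) (T : Type)
    (U : set_system T) (u : T -> V) (B : R) :
  UltraFilter U -> (\forall n \near U, `|u n| <= B) ->
  exists z : bidual V, forall g, (fun n => dfun g (u n)) @ U --> bfun z g.
Proof.
move=> UU uB.
have lim_ex g : exists l : R, (fun n => dfun g (u n)) @ U --> l.
  apply: (ultra_bounded_cvg (B := dnorm g * B) UU).
  apply: filterS uB => n /= un.
  by rewrite (le_trans (dfun_le g _))// ler_wpM2l ?dnorm_ge0.
have [l lE] := choice lim_ex.
have llin (a : R) (g h k : dual V) :
    (forall x, dfun k x = a * dfun g x + dfun h x) -> l k = a * l g + l h.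
  move=> kE; apply: (cvg_unique _ (lE k)) => //.
  rewrite (_ : (fun n => dfun k (u n)) =
    (fun n => a * dfun g (u n) + dfun h (u n))); last exact/funext.
  by apply: cvgD (lE h); apply: cvgM (lE g); exact: cvg_cst.
have lbd : exists C : R, forall g, `|l g| <= C * dnorm g.
  exists B => g; rewrite -(cvg_lim (@Rhausdorff R) (cvg_norm (lE g))).
  apply: limr_le; first exact: is_cvg_norm (cvgP _ (lE g)).
  apply: filterS uB => n /= un.
  by rewrite (le_trans (dfun_le g _))// mulrC ler_wpM2r ?dnorm_ge0.
by exists (Bidual llin lbd).
Qed.

(** * Separable spans and extraction of a weakly convergent subsequence *)

Section Span.
Variables (R : realType) (V : normedModType R) (u : nat -> V).

Definition comb (s : seq (nat * R)) : V := \sum_(x <- s) x.2 *: u x.1.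

(** Rational coefficients make the index type countable, so that these vectors can be enumerated. *)
Definition rat_comb (s : seq (nat * rat)) : V :=
  \sum_(x <- s) ratr x.2 *: u x.1.

Lemma combZ a s : comb [seq (x.1, a * x.2) | x <- s] = a *: comb s.
Proof.
rewrite /comb big_map scaler_sumr; apply: eq_bigr => x _ /=.
by rewrite scalerA.
Qed.

Lemma comb_cat s t : comb (s ++ t) = comb s + comb t.
Proof. exact: big_cat. Qed.

Lemma rat_comb_dense s e : 0 < e -> exists q, `|comb s - rat_comb q| < e.
Proof.
elim: s e => [|[n a] s IH] e e0.
  by exists [::]; rewrite /comb /rat_comb !big_nil subrr normr0.
have e2 : 0 < e / 2 by rewrite divr_gt0.
have [q sq] := IH _ e2.
have n0 : 0 < `|u n| + 1 by rewrite ltr_wpDl.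
(* A coefficient error of at most [d] costs at most [e / 2]; the added 1 covers [u n = 0]. *)
pose d := e / 2 / (`|u n| + 1).
have d0 : 0 < d by rewrite divr_gt0.
have [r] := @rat_in_itvoo R a (a + d) (ltac:(by rewrite ltrDl)).
rewrite in_itv /= => /andP[ar rd].
exists ((n, r) :: q); rewrite /comb /rat_comb !big_cons /=.
rewrite opprD addrACA -scalerBl [e]splitr.
apply: le_lt_trans (ler_normD _ _) _; rewrite ler_ltD//.
rewrite normrZ; apply: (@le_trans _ _ (d * (`|u n| + 1))).
  apply: ler_pM => //; last by rewrite lerDl.
  by rewrite distrC ger0_norm ?subr_ge0 ?(ltW ar)// lerBlDl ltW.
by rewrite /d divfK// gt_eqF.
Qed.

(** If [w] had distance at least [e] from the span, then [t *: w + comb s |-> t * e] would have norm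
    at most one, hence extend to a functional that kills every [u n] and equals [e] at [w]. *)
Lemma closed_span w :
  (forall g : dual V, (forall n, dfun g (u n) = 0) -> dfun g w = 0) ->
  forall e, 0 < e -> exists s, `|w - comb s| < e.
Proof.
move=> gw e e0; apply: contrapT => /forallNP far.
have {}far s : e <= `|w - comb s| by rewrite leNgt; apply/negP; exact: far.
pose S v r := exists t s, v = t *: w + comb s /\ r = t * e.
have comb0 : comb [::] = 0 by rewrite /comb big_nil.
have [||_ _ [t [s [-> ->]]]|g g1 gS] := @dual_extension _ _ S.
- by exists 0, [::]; rewrite scale0r mul0r add0r.
- move=> a _ _ _ _ [t [s [-> ->]]] [t' [s' [-> ->]]].
  exists (a * t + t'), ([seq (x.1, a * x.2) | x <- s] ++ s').
  by rewrite comb_cat combZ scalerDr scalerDl scalerA addrACA mulrDl mulrA.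
- have [->|t0] := eqVneq t 0; first by rewrite mul0r.
  have -> : t *: w + comb s = t *: (w - comb [seq (x.1, - t^-1 * x.2) | x <- s]).
    by rewrite combZ scalerBr scaleNr scalerN opprK scalerA divff// scale1r.
  rewrite normrZ; apply: (@le_trans _ _ (`|t| * e)).
    by rewrite ler_wpM2r ?ler_norm// ltW.
  by rewrite ler_wpM2l.
have gw0 : dfun g w = 0.
  apply: gw => n; apply: gS; exists 0, [:: (n, 1)].
  by rewrite /comb big_seq1 scale0r add0r scale1r mul0r.
have : dfun g w = e.
  by apply: gS; exists 1, [::]; rewrite scale1r comb0 addr0 mul1r.
by move=> we; rewrite -we gw0 ltxx in e0.
Qed.

(** The first condition on [w] is membership in the closed span, in dual form. The [G k] norm the
    rational combinations: if all vanish at [w] and [c] is such a combination near [w], then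
    [|c| <= |w - c|], so [w] is small. *)
Lemma countable_norming : exists G : nat -> dual V, forall w,
  (forall g : dual V, (forall n, dfun g (u n) = 0) -> dfun g w = 0) ->
  (forall k, dfun (G k) w = 0) -> w = 0.
Proof.
have normingq q : exists g, dnorm g <= 1 /\ dfun g (rat_comb q) = `|rat_comb q|.
  by have [g ? ?] := norming_functional (rat_comb q); exists g.
have [g_ g_E] := choice normingq.
(* Numbers that encode no list default to the empty combination. *)
exists (fun k => g_ (odflt [::] (unpickle k))) => w wu wG.
apply/eqP; rewrite -normr_eq0 eq_le normr_ge0 andbT.
apply/ler_addgt0Pr => e e0; rewrite add0r.
have e4 : 0 < e / 4 by rewrite divr_gt0.
have [s ws] := closed_span wu e4; have [q sq] := rat_comb_dense s e4.
have [/dnorm_le1P g1 gq] := g_E q.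
have gw : dfun (g_ q) w = 0 by have := wG (pickle q); rewrite pickleK.
have wq : `|w - rat_comb q| <= e / 2.
  have := ler_normD (w - comb s) (comb s - rat_comb q).
  by rewrite addrA subrK; lra.
have : `|rat_comb q| <= `|w - rat_comb q|.
  rewrite -gq -(subr0 (dfun _ _)) -gw -dfunB distrC.
  exact: le_trans (ler_norm _) (g1 _).
by have := ler_normD (w - rat_comb q) (rat_comb q); rewrite subrK; lra.
Qed.

End Span.

(* Testing against the countably many functionals of [countable_norming] already
   determines the weak limit, so a subsequence handling these (picked inside the
   members of one free ultrafilter) converges along every free ultrafilter to
   the same point. *)
Lemma weakly_cvg_subsequence (R : realType) (V : normedModType R)
    (u : nat -> V) :
  (forall U : set_system nat, UltraFilter U -> \oo `<=` U ->
    exists y, forall g : dual V, (fun n => dfun g (u n)) @ U --> dfun g y) ->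
  exists (phi : nat -> nat) (y : V),
    (forall n, (phi n < phi n.+1)%N) /\ weak_cvg (fun n => u (phi n)) y.
Proof.
move=> ulim.
have [G Gsep] := countable_norming u.
have [U [UU ooU]] := @ultraFilterLemma nat \oo _.
have [y uy] := ulim U UU ooU.
pose A n m := forall k : 'I_n.+1, `|dfun (G k) y - dfun (G k) (u m)| < n.+1%:R^-1.
(* Members of [U] contain indices beyond any bound, because [U] contains the tails. *)
have next (x : nat * nat) : exists m, (x.2 < m)%N /\ A x.1 m.
  case: x => n N /=.
  apply: (@filter_ex _ U); apply: filterI; first by apply: ooU; exists N.+1.
  apply: filter_forall => k.
  by have /cvgrPdist_lt/(_ n.+1%:R^-1) := uy (G k); apply; rewrite invr_gt0.
have [nxt nxtP] := choice next.
pose phi := fix phi n := if n is m.+1 then nxt (n, phi m) else nxt (n, 0%N).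
have phiS n : (phi n < phi n.+1)%N by have [] := nxtP (n.+1, phi n).
have phiA n : A n (phi n).
  by case: n => [|n]; [have [] := nxtP (0%N, 0%N)|have [] := nxtP (n.+1, phi n)].
have phi_ge n : (n <= phi n)%N.
  by elim: n => // n IH; exact: leq_ltn_trans (phiS n).
have phiG k : (fun n => dfun (G k) (u (phi n))) @ \oo --> dfun (G k) y.
  apply/cvgrPdist_lt => e e0; near=> n.
  have kn : (k < n.+1)%N by near: n; exists k.
  apply: lt_trans (phiA n (Ordinal kn)) _.
  near: n; have := @cvg_harmonic R.
  move/cvgrPdist_lt/(_ e e0); apply: filterS => n /=.
  by rewrite sub0r normrN ger0_norm.
exists phi, y; split=> // g N Ngy.
pose S := [set n | N (dfun g (u (phi n)))].
change (\oo S).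
apply: contrapT => nS.
(* [F] is generated by the tails and the complement of [S]; it is proper because [S] contains no
   tail. *)
pose F : set_system nat := [set B | \oo (S `|` B)].
have FP : ProperFilter F.
  split; first by rewrite /F /= setU0.
  split=> [|B C FB FC|B C BC FB].
  - by rewrite /F /= setUT; exact: filterT.
  - by rewrite /F /= setUIr; exact: filterI.
  - by apply: (@filterS _ \oo _ (S `|` B)) => // n [Sn|/BC]; [left|right].
have [W [WU FW]] := ultraFilterLemma FP.
have ooW : \oo `<=` W.
  by move=> B ooB; apply: FW; apply: filterS ooB => n Bn; right.
have WnS : W (~` S) by apply: FW; rewrite /F /= setUv; exact: filterT.
(* Since [n <= phi n], the image [phi @ W] contains the tails too, so the subsequence has a weak
   limit [y'] along [W]. *)
have [|y' uy'] := ulim (phi @ W) (ultra_fmap phi WU).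
  move=> B [M _ MB]; apply: ooW; exists M => // n /= Mn.
  by apply: MB; exact: leq_trans (phi_ge n).
have limW (h : nat -> R) (l : R) : h @ \oo --> l -> h @ W --> l.
  by move=> hl B /hl; exact: ooW.
(* Functionals killing every [u n] kill both limits, so [y' - y] lies in the closed span; the [G k]
   agree at [y] and [y'] by the choice of [phi]. *)
have y'y : y' - y = 0.
  apply: Gsep => [h hu|k].
    have lim0 (U' : set_system nat) (x : V) : ProperFilter U' ->
        (fun n => dfun h (u n)) @ U' --> dfun h x -> dfun h x = 0.
      move=> PU'; rewrite (_ : (fun n => _) = cst 0); last exact/funext.
      by move=> /(cvg_unique (@Rhausdorff R)); apply; exact: cvg_cst.
    by rewrite dfunB (lim0 _ _ _ (uy h)) (lim0 _ _ _ (uy' h)) subrr.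
  apply/eqP; rewrite dfunB subr_eq0; apply/eqP.
  exact: (cvg_unique (@Rhausdorff R) (uy' (G k)) (limW _ _ (phiG k))).
have WS : W S by apply: (uy' g); rewrite (subr0_eq y'y).
have : W set0 by rewrite -(setICr S); exact: filterI.
by move=> /filter_ex[].
Unshelve. all: by end_near. Qed.

(** * Minimizing sequences *)

(** The values are eventually below [r + 1], and coercivity at that level bounds the distance to the
    first point of the finite set. *)
Lemma minimizing_bounded (R : realType) (X Y : normedModType R) (iY : Y -> X)
    (iY_isometry : forall y : Y, `|iY y| = `|y|)
    (N : nat) (xs : 'I_N -> X) (f : ('I_N -> R) -> R) (ys : nat -> Y) (r : R) :
  (0 < N)%N -> in_Fcwmc f ->
  (fun n => rf f xs (iY (ys n))) @ \oo --> r ->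
  exists B : R, \forall n \near \oo, `|ys n| <= B.
Proof.
case: N xs f => // N xs f _ [_ [_ [_ [_ fcoer]]]] ysr.
have [K fK] := fcoer (r + 1).
exists (K + `|xs ord0|).
have /cvgrPdist_lt/(_ 1 ltr01) := ysr; apply: filterS => n /= rn.
rewrite -iY_isometry leNgt; apply/negP => Kn.
have : r + 1 <= rf f xs (iY (ys n)).
  apply: fK; first by move=> j; exact: normr_ge0.
  exists ord0.
  by have := ler_normB (iY (ys n) - xs ord0) (- xs ord0); rewrite opprK subrK normrN; lra.
by move: rn; rewrite distrC => /(le_lt_trans (ler_norm _)); lra.
Qed.

Lemma minimizing_ultralimit (R : realType) (X Y : normedModType R) (iY : Y -> X)
    (iY_linear : forall (a : R) (y1 y2 : Y),
      iY (a *: y1 + y2) = a *: iY y1 + iY y2)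
    (iY_isometry : forall y : Y, `|iY y| = `|y|)
    (hX : L_embedded X) (hY : L_embedded Y)
    (N : nat) (xs : 'I_N -> X) (f : ('I_N -> R) -> R) (ys : nat -> Y)
    (U : set_system nat) :
  (0 < N)%N -> in_Fcwmc f ->
  (fun n => rf f xs (iY (ys n))) @ \oo --> radf iY f xs ->
  UltraFilter U -> \oo `<=` U ->
  exists y, forall g : dual Y, (fun n => dfun g (ys n)) @ U --> dfun g y.
Proof.
move=> N0 hf ysr UU ooU.
have [B ooB] := minimizing_bounded iY_isometry N0 hf ysr.
have UB : \forall n \near U, `|ys n| <= B by exact: ooU.
have [z zE] := ultralimit_bidual UU UB.
have [p pL] := L_embedded_decomposition hX.
have [q qL] := L_embedded_decomposition hY.
set s := bnorm (bcomb (-1) (eval_at (q z)) z).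
(* [s] is the norm of the singular part of the limit [z]; if it vanishes, [z] is the point [q z]. *)
have [s0|s0] := eqVneq s 0.
  exists (q z) => g; suff -> : dfun g (q z) = bfun z g by [].
  apply/eqP; rewrite eq_sym -subr_eq0; apply/eqP.
  by have := bnorm_eq0 g s0; rewrite /= mulN1r addrC.
have {}s0 : 0 < s by rewrite lt_neqAle eq_sym s0 bnorm_ge0.
exfalso.
have aE (j : 'I_N) : exists a : R,
    (fun n => `|iY (ys n) - xs j|) @ U --> a.
  apply: (ultra_bounded_cvg (B := B + `|xs j|)) => //.
  apply: filterS UB => n /= nB; rewrite normr_id.
  by rewrite (le_trans (ler_normB _ _))// lerD2r iY_isometry.
have [a aP] := choice aE.
pose b j := `|iY (q z) - xs j|.
(* Weak-star lower semicontinuity of the norm, applied to [J z - x_j], whose norm is [b j + s]. *)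
have ba j : b j + s <= a j.
  rewrite -(L_decomposition_dist iY_linear iY_isometry _ _ pL qL).
  apply: bnorm_le => g g1 /=.
  have zg : (fun n => dfun g (iY (ys n) - xs j)) @ U -->
      -1 * dfun g (xs j) + bfun z (restrict iY_linear iY_isometry g).
    rewrite (_ : (fun n => _) = (fun n => -1 * dfun g (xs j) +
      dfun (restrict iY_linear iY_isometry g) (ys n))).
      by apply: cvgD (zE _); exact: cvg_cst.
    by apply/funext => n; rewrite /= dfunB; ring.
  apply: (ler_cvg_to zg (aP j)); apply: nearW => n /=.
  by apply: le_trans (ler_norm _) _; move/dnorm_le1P : g1.
have [_ [_ [fmono [fstrict _]]]] := hf.
(* Half of the gap is kept on each side: [b < c] makes [f b < f c], while [c < a] puts the distances
   above [c] eventually along [U], so that monotonicity alone gives [f c <= radf iY f xs]. *)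
pose c j := b j + s / 2.
have b0 : nonnegv b by move=> j; exact: normr_ge0.
have c0 : nonnegv c by move=> j; rewrite addr_ge0 ?b0// divr_ge0// ltW.
have fbc : f b < f c by apply: fstrict => // j; rewrite ltrDl divr_gt0.
have fcr : f c <= radf iY f xs.
  have Uf : (fun n => rf f xs (iY (ys n))) @ U --> radf iY f xs.
    by move=> A /ysr; exact: ooU.
  apply: (ler_cvg_to (cvg_cst (f c)) Uf).
  have : \forall n \near U, forall j, c j <= `|iY (ys n) - xs j|.
    apply: filter_forall => j; apply: cvgr_ge (aP j) _ _.
    by have := ba j; rewrite /c; lra.
  apply: filterS => n /= cn; apply: fmono => // j; exact: normr_ge0.
have : radf iY f xs <= f b.
  apply: ge_inf; last by exists (q z).
  exists 0 => _ [y _ <-]; have [f0 _] := hf.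
  by apply: f0 => j; exact: normr_ge0.
by lra.
Qed.

Theorem theorem3p8 (R : realType) (X Y : completeNormedModType R)
  (iY : Y -> X)
  (iY_linear : forall (a : R) (y1 y2 : Y), iY (a *: y1 + y2) = a *: iY y1 + iY y2)
  (iY_isometry : forall y : Y, `|iY y| = `|y|)
  (hX : L_embedded X) (hY : L_embedded Y) :
  forall (N : nat) (xs : 'I_N -> X), (0 < N)%N -> injective xs ->
  forall f : ('I_N -> R) -> R, in_Fcwmc f ->
  forall ys : nat -> Y,
    (fun n => rf f xs (iY (ys n))) @ \oo --> radf iY f xs ->
    exists (phi : nat -> nat) (y : Y),
      (forall n, (phi n < phi n.+1)%N) /\ weak_cvg (fun n => ys (phi n)) y.
Proof.
move=> N xs N0 _ f hf ys ysr.
apply: weakly_cvg_subsequence => U UU ooU.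
exact: (minimizing_ultralimit iY_linear iY_isometry hX hY N0 hf ysr).
Qed.
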